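(* Let $k\ge 3$ and $n>2k-1$. For every $0\leq j\leq |V^{(k)}_{n}|$, the word $\big(C^{j}(k\oplus W^{(k)}_{n-2k+1})\big)^2$ is a straddling square of $W^{(k)}_n$. Moreover, every straddling square $A^2$ of $W^{(k)}_{n}$ is of the form $A^2=\big(C^{j}(k\oplus W^{(k)}_{n-2k+1})\big)^2$ for some $0\leq j\leq |V^{(k)}_{n}|$.
   Context: Fix $k\ge3$. Words are over $\mathbb{N}$. Define the morphism $\varphi_k$ by $\varphi_k(ki+j)=(ki)(ki+j+1)$ if $0\le j\le k-2$ and $\varphi_k(ki+j)=(ki+j+1)$ if $j=k-1$; let $W^{(k)}_n=\varphi_k^n(0)$. It is known that for $n\ge k$, $W^{(k)}_n=W^{(k)}_{n-1}W^{(k)}_{n-2}\cdots W^{(k)}_{n-k+1}(k\oplus W^{(k)}_{n-k})$, where $m\oplus U$ adds $m$ to every digit of $U$. For $n\ge k$, a factor (occurrence) $A$ of $W^{(k)}_n$ is a straddling factor if $A=A_1A_2$ with $A_1,A_2$ nonempty, $A_1$ a suffix of $W^{(k)}_{n-1}\cdots W^{(k)}_{n-k+1}$ and $A_2$ a prefix of $k\oplus W^{(k)}_{n-k}$ in this decomposition; a straddling square is a straddling factor of the form $AA$. For $U=u_1\cdots u_p$ and $0\le j\le p-1$, $C^j(U)=u_{j+1}\cdots u_pu_1\cdots u_j$. For $n>2k-1$: $V^{(k)}_n=W^{(k)}_{n-2k}W^{(k)}_{n-2k-1}\cdots W^{(k)}_{0}$ if $2k-1<n<3k-2$, and $V^{(k)}_n=W^{(k)}_{n-2k}W^{(k)}_{n-2k-1}\cdots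 W^{(k)}_{n-3k+3}$ if $n\ge 3k-2$. *)

(* Defs.v *)
From mathcomp Require Import all_boot.

Set Implicit Arguments.
Unset Strict Implicit.
Unset Printing Implicit Defensive.

(* Words are [seq nat]; the cyclic shift C^j is [rot j]. *)

(* A digit is a = k * i + j with i = a %/ k and j = a %% k. *)
Definition phi_digit (k a : nat) : seq nat :=
  if a %% k == k.-1 then [:: a.+1] else [:: k * (a %/ k); a.+1].

Definition phi (k : nat) (U : seq nat) : seq nat :=
  flatten [seq phi_digit k a | a <- U].

Definition W (k n : nat) : seq nat := iter n (phi k) [:: 0].

Definition oplus (m : nat) (U : seq nat) : seq nat := [seq m + a | a <- U].

(* W_hi W_(hi-1) ... W_lo, with decreasing indices; empty when hi < lo. *)
Definition Wcat (k hi lo : nat) : seq nat :=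
  flatten [seq W k i | i <- rev (index_iota lo hi.+1)].

(* For n >= k, W k n = Wcat k (n - 1) (n - k + 1) ++ oplus k (W k (n - k)), and
   A1 ++ A2 occurs across the boundary of these two blocks. Meant for n >= k,
   so that the subtractions are not truncated. *)
Definition straddling_factor (k n : nat) (A : seq nat) : Prop :=
  infix A (W k n) /\
  exists A1 A2 : seq nat,
    [/\ A = A1 ++ A2, A1 != [::], A2 != [::],
        suffix A1 (Wcat k (n - 1) (n - k + 1))
      & prefix A2 (oplus k (W k (n - k)))].

Definition square (A : seq nat) : seq nat := A ++ A.

Definition straddling_square (k n : nat) (B : seq nat) : Prop :=
  straddling_factor k n B /\ exists A : seq nat, B = square A.

(* Meant for n >= 2 * k. The second lower index is n - 3k + 3, written so that
   no intermediate subtraction is truncated at n = 3k - 2. *)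
Definition V (k n : nat) : seq nat :=
  if n < 3 * k - 2 then Wcat k (n - 2 * k) 0
  else Wcat k (n - 2 * k) (n + 3 - 3 * k).

(* Main.v *)
Require Import Defs.
From mathcomp Require Import all_boot.
From mathcomp Require Import zify.

(** Put m = n - 2k + 1 and P = k (+) W_m. The left block ends with P, the right
    block R starts with P V, and after that V the word R disagrees with P; this
    gives the squares (C^j P)^2 for j <= |V| and no larger j.
    To see that |P| is the only period, use that the digit n occurs in W_n only
    as its last one, that the left block ends with W_(m+k), and that R has no
    digit 0 whereas every W_i starts with 0.
    If the boundary cuts the square A1 | B A1 B in its first half, then A1 is
    a suffix of W_(m+k) and B A1 ends at an occurrence of m + k in R. The
    first such occurrence ends P; a later one would force every
    k (+) W_(m+t), t < k, to be a prefix of B, hence R itself.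
    If it cuts B A2 B | A2 in its second half, then W_(m+k+s)...W_(m+k) is a
    suffix of B for every s < k - 1, hence so is the whole left block. *)

(** * Equalities between concatenations (Levi's lemma) *)

Lemma cat_eq_cat (T : Type) (a b c d : seq T) :
  a ++ b = c ++ d -> size a <= size c -> exists2 e, c = a ++ e & b = e ++ d.
Proof.
move=> eq_abcd le_ac; exists (drop (size a) c).
  have := congr1 (take (size a)) eq_abcd.
  by rewrite take_size_cat // takel_cat // => {1}->; rewrite cat_take_drop.
have := congr1 (drop (size a)) eq_abcd.
rewrite drop_size_cat // drop_cat; case: ltngtP le_ac => // eq_ac _.
by rewrite eq_ac subnn drop_size drop0.
Qed.

Lemma cat_eq_cat_r (T : Type) (a b c d : seq T) :
  a ++ b = c ++ d -> size d <= size b -> exists2 e, b = e ++ d & c = a ++ e.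
Proof.
move=> eq_abcd le_db; have := congr1 size eq_abcd; rewrite !size_cat => eq_size.
have [|e -> ->] := cat_eq_cat _ _ _ _ _ eq_abcd; first by lia.
by exists e.
Qed.

Lemma cat_injr (T : Type) (a c x : seq T) : a ++ x = c ++ x -> a = c.
Proof.
move/(congr1 rev); rewrite !rev_cat => /(congr1 (drop (size x))).
by rewrite -(size_rev x) !drop_size_cat // => /(can_inj revK).
Qed.

(** * Words that end with a strict maximum *)

Definition peak (x : nat) (U : seq nat) : Prop :=
  exists2 Y, U = rcons Y x & all (fun a => a < x) Y.

Lemma peak_cat x u v : peak x (u ++ v) -> v != [::] ->
  peak x v /\ all (fun a => a < x) u.
Proof.
case=> Y; case/lastP: v => [|v y]; first by [].
rewrite -rcons_cat => /rcons_inj[<- ->]; rewrite all_cat => /andP[ltu ltv] _.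
by split=> //; exists v.
Qed.

Lemma peak_mem x U : peak x U -> x \in U.
Proof. by case=> Y -> _; rewrite mem_rcons inE eqxx. Qed.

Lemma peak_le x U : peak x U -> all (fun a => a <= x) U.
Proof.
case=> Y -> /allP ltY; rewrite all_rcons leqnn.
by apply/allP => a /ltY /ltnW.
Qed.

Lemma peak_last x u v : peak x v -> last 0 (u ++ v) = x.
Proof. by case=> Y -> _; rewrite -rcons_cat last_rcons. Qed.

Lemma all_ltn_notin x U : all (fun a => a < x) U -> x \notin U.
Proof. by move/allP => ltU; apply/negP => /ltU; rewrite ltnn. Qed.

(** Both words end at the first occurrence of [x] in the common word. *)
Lemma peak_prefix x u v f g : peak x u -> peak x v -> u ++ f = v ++ g -> u = v.
Proof.
wlog le_uv: u v f g / size u <= size v => [IH pu pv eq_uv|pu pv].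
  by case: (leqP (size u) (size v)) => [|/ltnW] /IH; [|symmetry]; eauto.
case/cat_eq_cat/(_ le_uv) => e eq_v _; move: pv; rewrite eq_v.
have [->|e0] := eqVneq e [::]; first by rewrite cats0.
by case/peak_cat/(_ e0) => _ /all_ltn_notin; rewrite peak_mem.
Qed.

Lemma peak_oplus q x U : peak x U -> peak (q + x) (oplus q U).
Proof.
case=> Y -> ltY; exists (oplus q Y); first by rewrite /oplus map_rcons.
by rewrite all_map; apply: sub_all ltY => a /=; rewrite ltn_add2l.
Qed.

(** * The shift, the morphism and the words [W k n] *)

Lemma oplus_cat q U U' : oplus q (U ++ U') = oplus q U ++ oplus q U'.
Proof. exact: map_cat. Qed.

Lemma all_oplus q U : all (leq q) (oplus q U).
Proof. by rewrite all_map; apply/allP => a _ /=; rewrite leq_addr. Qed.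

Lemma phi_cat k U U' : phi k (U ++ U') = phi k U ++ phi k U'.
Proof. by rewrite /phi map_cat flatten_cat. Qed.

(** Adding [k] to a digit keeps its residue mod [k] and raises its quotient by one. *)
Lemma phi_oplus k U : 0 < k -> phi k (oplus k U) = oplus k (phi k U).
Proof.
move=> k0; elim: U => // a U IH.
rewrite -cat1s oplus_cat !phi_cat IH oplus_cat; congr (_ ++ _).
rewrite /phi /= !cats0 /phi_digit modnDl divnDl // divnn k0.
by case: ifP => _ /=; rewrite addnS // mulnDr muln1.
Qed.

Lemma WS k n : W k n.+1 = phi k (W k n).
Proof. by []. Qed.

(** A digit [b] produces only [b + 1] and possibly a multiple of [k] that is at most [b], so the new
    maximum [n + 1] comes only from the final [n]. *)
Lemma W_peak k n : peak n (W k n).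
Proof.
elim: n => [|n [Y WY ltY]]; first by exists [::].
rewrite WS WY -cats1 phi_cat.
have: all (fun a => a < n.+1) (phi k Y).
  apply/allP => a /flatten_mapP[b /(allP ltY) /= ltbn].
  have := leq_divM b k; rewrite mulnC /phi_digit => le_kb.
  by case: ifP => _; rewrite !inE; [move/eqP->|case/orP=> /eqP->]; lia.
move=> ltphi; rewrite /phi /= cats0 -/(phi k Y) /phi_digit.
case: ifP => _; first by exists (phi k Y); rewrite // cats1.
exists (rcons (phi k Y) (k * (n %/ k))); first by rewrite -!cats1 -catA.
by rewrite all_rcons ltphi andbT ltnS mulnC leq_divM.
Qed.

Lemma W_head k n : 1 < k -> exists Y, W k n = 0 :: Y.
Proof.
move=> k1; elim: n => [|n [Y WY]]; first by exists [::].
rewrite WS WY -cat1s phi_cat /phi /= /phi_digit mod0n div0n muln0.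
by case: k k1 {WY} => [|[|k]] //= _; eexists.
Qed.

(** [W k 0] is a prefix of [W k 1], and [phi] preserves prefixes. *)
Lemma W_prefix k i j : 1 < k -> i <= j -> exists Z, W k j = W k i ++ Z.
Proof.
move=> k1 /subnK <-; elim: (j - i) => [|d [Z WZ]]; first by exists [::]; rewrite cats0.
have [Z' WZ'] : exists Z', W k (d + i).+1 = W k (d + i) ++ Z'.
  elim: (d + i) => [|n [Z' WZ']]; last first.
    by exists (phi k Z'); rewrite WS WZ' phi_cat -WZ'.
  by have [Z' WZ'] := W_head k 1 k1; exists Z'.
by exists (Z ++ Z'); rewrite addSn WZ' WZ catA.
Qed.

Lemma size_WS k n : size (W k n.+1) <= 2 * size (W k n).
Proof.
rewrite WS; elim: (W k n) => // a U IH.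
have -> : phi k (a :: U) = phi_digit k a ++ phi k U by [].
by rewrite size_cat /phi_digit; case: ifP => _ /=; lia.
Qed.

(* W_(b-1) ... W_a: here, unlike in [Wcat], the upper bound is excluded. *)
Definition Wrange (k a b : nat) : seq nat :=
  flatten [seq W k i | i <- rev (index_iota a b)].

Lemma Wrange_nil k a b : b <= a -> Wrange k a b = [::].
Proof. by move=> le_ba; rewrite /Wrange /index_iota (eqP (_ : b - a == 0)). Qed.

Lemma Wrange_cat k a b c : a <= b -> b <= c ->
  Wrange k a c = Wrange k b c ++ Wrange k a b.
Proof.
move=> ab bc; rewrite /Wrange -flatten_cat -map_cat -rev_cat /index_iota.
by rewrite -{2}(subnKC ab) -iotaD; congr (flatten (map _ (rev (iota _ _)))); lia.
Qed.

Lemma Wrange1 k a : Wrange k a a.+1 = W k a.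
Proof. by rewrite /Wrange /index_iota subSnn /= cats0. Qed.

Lemma WrangeS k a b : a <= b -> Wrange k a b.+1 = W k b ++ Wrange k a b.
Proof. by move=> ab; rewrite (@Wrange_cat k a b) // Wrange1. Qed.

Lemma Wrange_recl k a b : a < b -> Wrange k a b = Wrange k a.+1 b ++ W k a.
Proof. by move=> ab; rewrite (@Wrange_cat k a a.+1) // Wrange1. Qed.

Lemma phi_Wrange k a b : phi k (Wrange k a b) = Wrange k a.+1 b.+1.
Proof.
have [ba|/ltnW ab] := leqP b a; first by rewrite !Wrange_nil.
rewrite -(subnKC ab); elim: (b - a) => [|d IH].
  by rewrite addn0 !Wrange_nil.
rewrite addnS WrangeS ?leq_addr // phi_cat IH -WS.
by rewrite [in RHS]WrangeS // ltnS leq_addr.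
Qed.

(** * The decomposition of [W k n] *)

(** The last block of [W k n]: for [n < k] the factors before it already go down to [W k 0], and
    only the digit [n] is left. *)
Definition Wtail (k n : nat) : seq nat :=
  if n < k then [:: n] else oplus k (W k (n - k)).

(** Apply [phi] blockwise. While [n + 1 < k], the digit [n] becomes [0] and [n + 1], and this [0] is
    the new factor [W k 0]. *)
Lemma W_decomp k n : 1 < k -> W k n = Wrange k (n.+1 - k) n ++ Wtail k n.
Proof.
move=> k1; elim: n => [|n IH].
  by rewrite Wrange_nil // /Wtail (ltnW k1).
rewrite WS {}IH phi_cat phi_Wrange /Wtail.
have [ltnk|lekn] := ltnP n k; last first.
  by rewrite ifF ?ltnNge ?(leqW lekn) // phi_oplus 1?ltnW // -WS !subSn // leqW.
have phin : phi k [:: n] = if n == k.-1 then [:: n.+1] else [:: 0; n.+1].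
  by rewrite /phi /= cats0 /phi_digit modn_small // divn_small // muln0.
rewrite phin; case: eqP => [nk|/eqP nk].
  have -> : k = n.+1 by lia.
  by rewrite ltnn subnn subSnn /oplus /= addn0.
have -> : n.+1 < k by lia.
have -> : n.+2 - k = 0 by lia.
have -> : n.+1 - k = 0 by lia.
by rewrite (@Wrange_recl k 0) // -catA.
Qed.

Lemma Wrange_head k a b : 1 < k -> a < b -> exists Z, Wrange k a b = 0 :: Z.
Proof.
move=> k1; case: b => // b ab; rewrite WrangeS //.
by have [Y ->] := W_head k b k1; exists (Y ++ Wrange k a b).
Qed.

(** The bounds on [a] ensure that the decomposition of [W k b] has a further factor below [a], and
    every factor begins with [0]. *)
Lemma W_decomp_head k a b : 1 < k -> 0 < a -> a <= b -> b.+1 < a + k ->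
  exists Z, W k b = Wrange k a b ++ 0 :: Z.
Proof.
move=> k1 a0 ab bk; rewrite W_decomp // (@Wrange_cat k (b.+1 - k) a) //; last by lia.
have [|Z ->] := @Wrange_head k (b.+1 - k) a k1; first by lia.
by exists (Z ++ Wtail k b); rewrite -catA.
Qed.

(** * The period of a straddling square *)

(** If [X] starts inside a factor [W k i], its part there ends with [i]. As the words [W k j] are
    prefixes of one another, this part is also a prefix of [W k i], where [i] occurs only last, so
    it is the whole factor. *)
Lemma Wrange_border k a b e X j : 1 < k -> a <= b -> Wrange k a b = e ++ X ->
  prefix X (W k j) -> exists b', [/\ a <= b', b' <= b & X = Wrange k a b'].
Proof.
move=> k1; elim: b e => [|b IH] e ab eqX preX.
  exists 0; split=> //; move: eqX; rewrite Wrange_nil //.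
  by case: e => //= <-.
have [eq_a|ne_a] := eqVneq a b.+1.
  exists b.+1; split; rewrite ?eq_a //; move: eqX; rewrite Wrange_nil ?eq_a //.
  by case: e => //= <-; rewrite Wrange_nil.
have {}ab : a <= b by lia.
rewrite WrangeS // in eqX.
have size_eq := congr1 size eqX; rewrite !size_cat in size_eq.
have [le_Xb|lt_bX] := leqP (size X) (size (Wrange k a b)).
  have [|e' _ eqX'] := cat_eq_cat _ _ _ _ _ eqX; first by lia.
  by have [b' [ab' b'b ->]] := IH e' ab eqX' preX; exists b'; split=> //; lia.
have [|Q eqW eqXQ] := cat_eq_cat _ _ _ _ _ (esym eqX); first by lia.
have Q0 : Q != [::] by case: (Q) eqXQ lt_bX => // ->; rewrite ltnn.
have := W_peak k b; rewrite eqW => /peak_cat/(_ Q0)[peakQ _].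
have [Z WZ] := W_prefix k _ _ k1 (leq_maxl b j).
have [Z' WZ'] := W_prefix k _ _ k1 (leq_maxr b j).
have /prefixP[F WF] := preX.
have : W k b ++ Z = Q ++ (Wrange k a b ++ F ++ Z').
  by rewrite -WZ WZ' WF eqXQ -!catA.
case/esym/cat_eq_cat => [|f WQf _]; first by rewrite eqW size_cat leq_addl.
exists b.+1; split; [exact: leqW | by [] | rewrite WrangeS // WQf eqXQ].
have := W_peak k b; rewrite WQf; have [->|f0] := eqVneq f [::]; first by rewrite cats0.
by case/peak_cat/(_ f0) => _ /all_ltn_notin; rewrite (peak_mem _ _ peakQ).
Qed.

(* The square is [A1 B A1 B], cut after its first [A1]. *)
Lemma right_period k m A1 B L F : 2 < k ->
  Wrange k (m + k) (m + 2 * k - 1) = L ++ A1 -> A1 != [::] ->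
  oplus k (W k (m + k - 1)) = B ++ A1 ++ B ++ F ->
  B ++ A1 = oplus k (W k m).
Proof.
move=> k2 eqL A1n0 eqR; have k1 : 1 < k by lia.
have ge_k : all (leq k) (B ++ A1 ++ B ++ F) by rewrite -eqR all_oplus.
have no0 : 0 \notin A1.
  move: ge_k; rewrite !all_cat => /and3P[_ geA1 _].
  by apply/negP => /(allP geA1) /=; lia.
have peakA1 : peak (m + k) A1.
  rewrite Wrange_recl in eqL; last by lia.
  have size_eq := congr1 size eqL; rewrite !size_cat in size_eq.
  have [le_A1|lt_A1] := leqP (size A1) (size (W k (m + k))).
    have [|e _ eqW] := cat_eq_cat _ _ _ _ _ eqL; first by lia.
    by have := W_peak k (m + k); rewrite eqW => /peak_cat/(_ A1n0)[].
  have [|e _ eqA1] := cat_eq_cat _ _ _ _ _ (esym eqL); first by lia.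
  have [Y WY] := W_head k (m + k) k1.
  by move: no0; rewrite eqA1 WY mem_cat inE eqxx orbT.
have [A0 eqA1 ltA0] := peakA1.
have notA0 := all_ltn_notin _ _ ltA0.
have peakP t : peak (m + k + t) (oplus k (W k (m + t))).
  by have := peak_oplus k _ _ (W_peak k (m + t)); congr (peak _ _); lia.
have prefR t : t <= k - 1 ->
    exists Z, B ++ A1 ++ B ++ F = oplus k (W k (m + t)) ++ Z.
  move=> lt_tk; have [|Z WZ] := W_prefix k (m + t) (m + k - 1) k1; first by lia.
  by exists (oplus k Z); rewrite -eqR WZ oplus_cat.
have [//|Z0] := prefR 0; rewrite addn0 => eqZ0.
have := peakP 0; rewrite !addn0 => peakP0.
(* The digit [m + k] ends [A1] and occurs in [oplus k (W k m)] only last, so [B ++ A1] cannot be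
   shorter. The longer case is refuted below. *)
have [leBA|ltBA] := leqP (size (B ++ A1)) (size (oplus k (W k m))).
  have := eqZ0; rewrite catA => /cat_eq_cat/(_ leBA)[e eqP _].
  have [e0|e0] := eqVneq e [::]; first by rewrite eqP e0 cats0.
  move: peakP0; rewrite eqP => /peak_cat/(_ e0)[_ /all_ltn_notin].
  by rewrite mem_cat (peak_mem _ _ peakA1) orbT.
have prefB0 : exists e, B = oplus k (W k m) ++ e.
  have [leB|ltB] := leqP (size (oplus k (W k m))) (size B).
    by have [e -> _] := cat_eq_cat _ _ _ _ _ (esym eqZ0) leB; exists e.
  have [e eqP eqA] := cat_eq_cat _ _ _ _ _ eqZ0 (ltnW ltB).
  have e0 : e != [::] by apply: contraTneq ltB => e0; rewrite eqP e0 cats0 ltnn.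
  move: peakP0; rewrite eqP => /peak_cat/(_ e0)[/peak_mem eM _].
  move: eqA; rewrite eqA1 -cats1 -catA => /esym/cat_eq_cat[|e' eqA _].
    by move: ltBA; rewrite eqP eqA1 !size_cat size_rcons; lia.
  by case/negP: notA0; rewrite eqA mem_cat eM.
have prefB t : t <= k - 1 -> exists e, B = oplus k (W k (m + t)) ++ e.
  elim: t => [_|t IH lt_tk]; first by rewrite addn0.
  have [|e eqB] := IH; first by lia.
  have [Z eqZ] := prefR t.+1 lt_tk.
  have [leB|/ltnW ltB] := leqP (size (oplus k (W k (m + t.+1)))) (size B).
    by have [f -> _] := cat_eq_cat _ _ _ _ _ (esym eqZ) leB; exists f.
  have [f eqP eqA] := cat_eq_cat _ _ _ _ _ eqZ ltB.
  have [f0|f0] := eqVneq f [::].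
    by exists [::]; rewrite eqP f0 !cats0.
  have := peakP t.+1; rewrite eqP => /peak_cat/(_ f0)[/peak_mem mf notB].
  (* [B] already contains the previous word and [phi] at most doubles lengths, so the overhang [f]
     is no longer than [B]. *)
  have le_f : size f <= size (A1 ++ B).
    have := congr1 size eqP; have := congr1 size eqB.
    have := size_WS k (m + t); rewrite -addnS !size_cat !size_map; lia.
  move: eqA; rewrite catA => /esym/cat_eq_cat/(_ le_f)[g eqAB _].
  have : m + k + t.+1 \in A1 ++ B by rewrite eqAB mem_cat mf.
  rewrite mem_cat (negPf (all_ltn_notin _ _ notB)) orbF.
  by move/(allP (peak_le _ _ peakA1)); lia.
have [//|e eqB] := prefB (k - 1).
have := congr1 size eqR; rewrite eqB addnBA ?(ltnW k1) // !size_cat.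
have : 0 < size A1 by case: (A1) A1n0.
by lia.
Qed.

(* The square is [B A2 B A2], cut before its last [A2]. *)
Lemma no_square_centered_left k m A2 B Y F : 2 < k ->
  Wrange k (m + k) (m + 2 * k - 1) = Y ++ B ++ A2 ++ B ->
  A2 != [::] -> B != [::] ->
  oplus k (W k (m + k - 1)) = A2 ++ F -> False.
Proof.
move=> k2 eqL A2n0 Bn0 eqR; have k1 : 1 < k by lia.
have no0 : 0 \notin A2.
  have := all_oplus k (W k (m + k - 1)); rewrite eqR all_cat => /andP[/allP geA2 _].
  by apply/negP => /geA2; lia.
suff sufB s : s < k -> exists C, B = C ++ Wrange k (m + k) (m + k + s).
  have [|C eqB] := sufB (k - 1); first by lia.
  have := congr1 size eqL; rewrite !size_cat.
  have : 0 < size A2 by case: (A2) A2n0.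
  rewrite (_ : m + 2 * k - 1 = m + k + (k - 1)); last by lia.
  by rewrite {2}eqB size_cat; lia.
elim: s => [_|s IH lt_sk].
  by exists B; rewrite addn0 Wrange_nil // cats0.
have [|C eqB] := IH; first by lia.
set X := Wrange k (m + k) (m + k + s) in eqB.
set M := m + k + s; set L := Wrange k M.+1 (m + 2 * k - 1).
have eqXS : Wrange k (m + k) (m + k + s.+1) = W k M ++ X.
  by rewrite addnS WrangeS // leq_addr.
have {eqL}eqM : L ++ W k M = Y ++ C ++ X ++ A2 ++ C.
  move: eqL; rewrite (@Wrange_cat k (m + k) M.+1); [|lia|lia].
  rewrite -addnS eqXS {2}eqB !catA => /cat_injr.
  by rewrite eqB -!catA addnS.
(* [W k M] inside [C] gives the claim; if it starts inside [A2], then [A2] contains its initial [0];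
   if it starts further left, [U] is its part before [A2]. *)
have [le_MC|lt_CM] := leqP (size (W k M)) (size C).
  have [|D eqC _] := cat_eq_cat_r _ (Y ++ C ++ X ++ A2) C L (W k M) _ le_MC.
    by rewrite eqM -!catA.
  by exists D; rewrite eqXS eqB eqC catA.
have [Y0 WM0] := W_head k M k1.
have [le_MAC|lt_ACM] := leqP (size (W k M)) (size (A2 ++ C)).
  have [|D eqAC _] := cat_eq_cat_r _ (Y ++ C ++ X) (A2 ++ C) L (W k M) _ le_MAC.
    by rewrite eqM -!catA.
  have [e eqW eqA2] := cat_eq_cat_r _ _ _ _ _ (esym eqAC) (ltnW lt_CM).
  have : e != [::] by apply: contraTneq lt_CM => e0; rewrite eqW e0 ltnn.
  case: e eqW eqA2 => // a e; rewrite WM0 => -[<- _] eqA2 _.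
  by move: no0; rewrite eqA2 mem_cat inE eqxx orbT.
have [|U eqW _] := cat_eq_cat_r _ L (W k M) (Y ++ C ++ X) (A2 ++ C) _ (ltnW lt_ACM).
  by rewrite eqM -!catA.
have U0 : U != [::] by apply: contraTneq lt_ACM => U0; rewrite eqW U0 ltnn.
have AC0 : A2 ++ C != [::] by case: (A2) A2n0.
have := W_peak k M; rewrite eqW => /peak_cat/(_ AC0)[peakAC ltU].
have eqU : L ++ U = Y ++ C ++ X.
  by apply: (cat_injr nat _ _ (A2 ++ C)); rewrite -!catA -eqW eqM.
have [C0|Cn0] := eqVneq C [::].
  (* Then [A2 = oplus k (W k (m + s))], preceded by [m + s + 1] in [W k M] but
     by [m + k] at the end of [X]. *)
  rewrite C0 /= ?cats0 in eqB eqW eqU peakAC.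
  have s0 : 0 < s.
    rewrite lt0n; apply: contra Bn0 => /eqP s0.
    by rewrite eqB /X s0 addn0 Wrange_nil.
  have MkE : M - k = m + s by lia.
  have peakT : peak M (oplus k (W k (M - k))).
    by have := peak_oplus k _ _ (W_peak k (M - k)); rewrite subnKC //; lia.
  have eqA2 : A2 = oplus k (W k (M - k)).
    have [|Z WZ] := W_prefix k (M - k) (m + k - 1) k1; first by lia.
    by apply: (peak_prefix _ _ _ F (oplus k Z) peakAC peakT); rewrite -eqR WZ oplus_cat.
  have := W_decomp k M k1; rewrite /Wtail ifF; last by lia.
  rewrite eqW -eqA2 => /cat_injr eqU'.
  move: eqU; rewrite eqU' /X Wrange_recl; last by lia.
  rewrite [in RHS]Wrange_recl; last by lia.
  rewrite !catA => /(congr1 (last 0)).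
  by rewrite !(peak_last _ _ _ (W_peak _ _)); lia.
have peakC : peak M C by have [] := peak_cat _ _ _ peakAC Cn0.
(* [C] ends with [M], a digit absent from [U], so the suffix [U] of [Y ++ C ++ X] stays inside
   [X]. *)
have leUX : size U <= size X.
  rewrite leqNgt; apply/negP => ltXU.
  have [|e eqUe] := cat_eq_cat_r _ L U (Y ++ C) X _ (ltnW ltXU).
    by rewrite eqU catA.
  have: e != [::] by apply: contraTneq ltXU => e0; rewrite eqUe e0 ltnn.
  case/lastP: e eqUe => // e z eqUe _ /(congr1 (last 0)).
  rewrite (peak_last _ _ _ peakC) last_cat last_rcons => Mz.
  by have := all_ltn_notin _ _ ltU; rewrite eqUe mem_cat mem_rcons inE Mz eqxx.
have [e eqX _] : exists2 e, X = e ++ U & L = (Y ++ C) ++ e.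
  by apply: cat_eq_cat_r leUX; rewrite eqU catA.
(* So [U] is a product of factors down to [W k (m + k)], after which [W k M] has a [0]; but [A2]
   starts there. *)
have [||b [ab bs eqUb]] := Wrange_border k (m + k) (m + k + s) e U M k1 _ eqX.
- by rewrite leq_addr.
- by rewrite eqW prefix_prefix.
have [|||Z WZ] := W_decomp_head k (m + k) b k1; [lia|lia|lia|].
have [|Z' WZ'] := W_prefix k b M k1; first by lia.
have := eqW; rewrite WZ' WZ -eqUb -catA => /eqP; rewrite eqseq_cat // eqxx => /eqP.
by case: (A2) A2n0 no0 => //= a A2' _ no0 [a0 _]; rewrite -a0 inE eqxx in no0.
Qed.

(** * The admissible cyclic shifts *)

(** Truncated subtraction merges the two cases of [V]: [n + 3 - 3 * k] is [0] when
    [n < 3 * k - 2]. *)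
Lemma V_Wrange k n : 1 < k -> 2 * k <= n ->
  V k n = Wrange k (n - 2 * k + 1 + 2 - k) (n - 2 * k + 1).
Proof.
move=> k1 le_n; rewrite /V; case: ifP => lt_n; rewrite /Wcat -/(Wrange k _ _);
  by congr Wrange; lia.
Qed.

(** After [U], the word [W k m] goes on with [W k (m + 1 - k)], which begins with [0], whereas the
    last block of [W k m.+1] begins with [k]. For [m + 1 < k] these digits are [m] and [m + 1]
    instead. *)
Lemma W_fork k m : 1 < k -> let U := Wrange k (m + 2 - k) m in
  exists x y Z Z', [/\ W k m = U ++ x :: Z, W k m.+1 = W k m ++ U ++ y :: Z'
    & x != y].
Proof.
move=> k1 U.
have WmS : W k m.+1 = W k m ++ U ++ Wtail k m.+1.
  rewrite W_decomp // (_ : m.+2 - k = m + 2 - k); last by lia.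
  by rewrite WrangeS ?catA //; lia.
have Wm : W k m = U ++ Wrange k (m.+1 - k) (m + 2 - k) ++ Wtail k m.
  by rewrite W_decomp // (@Wrange_cat k _ (m + 2 - k)) ?catA //; lia.
have [lt_mk|le_km] := ltnP m.+1 k.
  exists m, m.+1, [::], [::]; rewrite WmS {1}Wm Wrange_nil; last by lia.
  by rewrite /Wtail lt_mk (ltnW lt_mk); split=> //; lia.
have [|Z eqZ] := @Wrange_head k (m.+1 - k) (m + 2 - k) k1; first by lia.
have [Z' eqZ'] := W_head k (m.+1 - k) k1.
exists 0, k, (Z ++ Wtail k m), (oplus k Z'); split; last by lia.
- by rewrite Wm eqZ.
- by rewrite WmS /Wtail ltnNge le_km eqZ' /= addn0.
Qed.

Theorem theorem38 (k n : nat) (hk : 3 <= k) (hn : 2 * k - 1 < n) :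
  (forall j : nat, j <= size (V k n) ->
     straddling_square k n
       (square (rot j (oplus k (W k (n - 2 * k + 1)))))) /\
  (forall A : seq nat, straddling_square k n (square A) ->
     exists j : nat, j <= size (V k n) /\
       square A = square (rot j (oplus k (W k (n - 2 * k + 1))))).
Proof.
have k1 : 1 < k by lia.
rewrite V_Wrange //; last by lia.
set m := n - 2 * k + 1; set U := Wrange k (m + 2 - k) m.
have [x [y [Z [Z' [Wm WmS ne_xy]]]]] := W_fork k m k1; rewrite -/U in Wm WmS.
set P := oplus k (W k m).
have [|F WF] := W_prefix k m.+1 (m + k - 1) k1; first by lia.
have eqR : oplus k (W k (m + k - 1)) =
    P ++ oplus k U ++ (k + y) :: oplus k (Z' ++ F).
  by rewrite WF WmS -!catA 2!oplus_cat.
have defP : P = oplus k U ++ (k + x) :: oplus k Z by rewrite /P Wm oplus_cat.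
(* The last factor [W k (m + k)] of the left block ends with its own last block, which is [P]. *)
have eqL : exists L, Wrange k (m + k) (m + 2 * k - 1) = L ++ P.
  rewrite Wrange_recl; last by lia.
  rewrite W_decomp // /Wtail ifF ?addnK; last by lia.
  by rewrite catA; eexists.
have eqn : [/\ n - k = m + k - 1, n - k + 1 = m + k & (n - 1).+1 = m + 2 * k - 1].
  by split; rewrite /m; lia.
have eqW : W k n = Wrange k (m + k) (m + 2 * k - 1) ++ oplus k (W k (m + k - 1)).
  rewrite W_decomp // /Wtail ifF; last by lia.
  by case: eqn => -> e1 e2; congr (Wrange k _ _ ++ _); lia.
rewrite /straddling_square /straddling_factor /Wcat -/(Wrange k _ _).
case: eqn => -> -> ->; split=> [j le_j|A].
  have lt_jP : j < size P.
    by rewrite defP size_cat size_map /= addnS ltnS (leq_trans le_j) // leq_addr.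
  have [L {}eqL] := eqL.
  split; last by exists (rot j P).
  have eqS : square (rot j P) = drop j P ++ P ++ take j P.
    by rewrite /square /rot -!catA (catA (take j P)) cat_take_drop.
  (* As [j <= size U], [take j P] is also a prefix of [oplus k U], which follows [P] in the right
     block. *)
  have preT : prefix (P ++ take j P) (oplus k (W k (m + k - 1))).
    rewrite eqR [X in take j X]defP takel_cat ?size_map //.
    rewrite -{2}(cat_take_drop j (oplus k U)) !catA -!catA catA.
    exact: prefix_prefix.
  have sufT : suffix (drop j P) (Wrange k (m + k) (m + 2 * k - 1)).
    by rewrite eqL -{2}(cat_take_drop j P) catA; apply: suffix_suffix.
  rewrite eqS; split.
    rewrite eqW; have /prefixP[G ->] := preT; have /suffixP[G' ->] := sufT.
    by apply/infixP; exists G', G; rewrite -!catA.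
  exists (drop j P), (P ++ take j P); split=> //.
    by rewrite -size_eq0 size_drop -lt0n subn_gt0.
  by rewrite -size_eq0 size_cat addn_eq0 negb_and -lt0n (leq_ltn_trans _ lt_jP).
case=> [[_ [A1 [A2 [eqA A1n0 A2n0 /suffixP[L0 eqL0] /prefixP[F0 eqR0]]]]] _].
have [leA1|ltA] := leqP (size A1) (size A); last first.
  have [B eqA1 eqA2] := cat_eq_cat _ _ _ _ _ eqA (ltnW ltA).
  have B0 : B != [::] by apply: contraTneq ltA => B0; rewrite eqA1 B0 cats0 ltnn.
  case: (no_square_centered_left k m A2 B L0 F0 hk _ A2n0 B0 eqR0).
  by rewrite eqL0 eqA1 {1}eqA2 -!catA.
(* [B] is empty when the boundary separates the two halves. *)
have [B eqAB eqA2] := cat_eq_cat _ _ _ _ _ (esym eqA) leA1.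
have eqRB : oplus k (W k (m + k - 1)) = B ++ A1 ++ B ++ F0.
  by rewrite eqR0 eqA2 {1}eqAB -!catA.
have eqBA : B ++ A1 = P := right_period k m A1 B L0 F0 hk eqL0 A1n0 eqRB.
exists (size B); split; last by rewrite -/P -eqBA rot_size_cat -eqAB.
rewrite leqNgt -(size_map (addn k)) -/(oplus k U); apply/negP => ltUB.
have ltUP : size (oplus k U) < size P by rewrite -eqBA size_cat ltn_addr.
(* In the right block [P] is followed by [B], itself a prefix of [P]; at position [size (oplus k U)]
   this [B] would have both [k + y] and [k + x]. *)
move: eqRB; rewrite eqR (catA B) eqBA => /eqP; rewrite eqseq_cat // eqxx => /eqP.
move/(congr1 (nth 0 ^~ (size (oplus k U)))).
rewrite [RHS]nth_cat ltUB nth_cat ltnn subnn /=.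
have := congr1 (nth 0 ^~ (size (oplus k U))) eqBA.
rewrite defP [LHS]nth_cat ltUB nth_cat ltnn subnn /= => -> /addnI eq_yx.
by rewrite eq_yx eqxx in ne_xy.
Qed.
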